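(* Let $n\ge 1$ be an integer and let $\eta_1,\dots,\eta_n$ be centered ($\mathbf{E}\eta_j=0$) subgaussian random variables on a common probability space which are pairwise disjoint, i.e. $\eta_i\eta_j=0$ almost everywhere for $i\neq j$. Put $\beta_j=\|\eta_j\|_{\mathrm{Sub}}$ and $S(n)=\sum_{j=1}^n\eta_j$. Then $$\|S(n)\|_{\mathrm{Sub}}\le G_n(\beta_1^2,\beta_2^2,\dots,\beta_n^2),$$ where $$G_n(y_1,\dots,y_n)=\sup_{\mu>0}\left[\mu^{-1}\ln\left(\sum_{j=1}^n e^{\mu y_j}-(n-1)\right)\right]^{1/2}.$$
   Context: A real random variable $\xi$ with $\mathbf{E}\xi=0$ is called subgaussian if there is $\tau\ge 0$ such that $\mathbf{E}e^{\lambda\xi}\le e^{\lambda^2\tau^2/2}$ for all $\lambda\in\mathbb{R}$; the smallest such $\tau$ is its subgaussian norm $\|\xi\|_{\mathrm{Sub}}$. *)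

(* Defs.v *)
From HB Require Import structures.
From mathcomp Require Import all_boot all_order all_algebra.
From mathcomp Require Import all_classical all_reals all_analysis.

Set Implicit Arguments.
Unset Strict Implicit.
Unset Printing Implicit Defensive.

Import Order.TTheory GRing.Theory Num.Theory.
Import numFieldNormedType.Exports.

Local Open Scope classical_set_scope.
Local Open Scope ring_scope.

Section Subgaussian.
Context (d : measure_display) (T : measurableType d) (R : realType).
Variable P : probability T R.

Definition sub_bound (X : T -> R) (tau : R) : Prop :=
  0 <= tau /\
  forall lambda : R,
    ('M_P X lambda <= (expR (lambda ^+ 2 * tau ^+ 2 / 2))%:E)%E.

Definition subgaussian (X : {RV P >-> R}) : Prop :=
  ('E_P[X] = 0)%E /\ exists tau : R, sub_bound X tau.

(* The set of admissible tau is closed, so when it is nonempty this infimum is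
   the smallest admissible tau; it is +oo exactly when there is none. *)
Definition sub_norm (X : T -> R) : \bar R :=
  ereal_inf [set tau%:E | tau in [set tau | sub_bound X tau]].

End Subgaussian.

(* The supremum is taken in the extended reals because the supremum of an
   unbounded set of reals is 0 in the library. For nonnegative y the argument
   of ln is at least 1, so neither ln nor Num.sqrt is used outside its domain,
   and the supremum is finite. *)
Definition Gfun (R : realType) (n : nat) (y : 'I_n -> R) : \bar R :=
  ereal_sup
    [set (Num.sqrt
            (mu^-1 * ln (\sum_(j < n) expR (mu * y j) - (n%:R - 1))))%:E
    | mu in [set mu : R | 0 < mu]].

(* Main.v *)
(* By disjointness, almost everywhere at most one eta j is nonzero, whence
   exp (t S) = \sum_j exp (t eta_j) - (n - 1). Taking expectations, with the
   infimum defining each norm attained, gives E exp (t S) <= A (t^2 / 2) where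
   A mu = \sum_j exp (mu beta_j^2) - (n - 1), and A mu <= exp (mu G^2) is what
   the supremum defining G says at mu. *)
Require Import Defs.
From HB Require Import structures.
From mathcomp Require Import all_boot all_order all_algebra.
From mathcomp Require Import all_classical all_reals all_analysis.
From mathcomp Require Import measurable_realfun.
From mathcomp Require Import lra.

Set Implicit Arguments.
Unset Strict Implicit.
Unset Printing Implicit Defensive.

Import Order.TTheory GRing.Theory Num.Theory.
Import numFieldNormedType.Exports.

Local Open Scope classical_set_scope.
Local Open Scope ring_scope.

(** At most one [x k] is nonzero and each other index contributes [expR 0 = 1] on the right, so both
    sides equal [expR (x k) + n]; if all vanish, both equal [n + 1]. *)
Lemma expR_sum_disjoint (R : realType) (n : nat) (x : 'I_n -> R) :
  (forall i j, i != j -> x i * x j = 0) ->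
  expR (\sum_(j < n) x j) + n%:R = \sum_(j < n) expR (x j) + 1.
Proof.
move=> x_disj.
have [/existsP[k xk_neq0]|/existsPn x_eq0] := boolP [exists k, x k != 0].
  have x0 j : j != k -> x j = 0.
    by move=> /x_disj/eqP; rewrite mulf_eq0 (negPf xk_neq0) orbF => /eqP.
  rewrite (bigD1 k)//= [X in expR (_ + X)]big1 ?addr0; last by move=> j /x0.
  rewrite [in RHS](bigD1 k)//= -addrA; congr (_ + _).
  rewrite (eq_bigr (fun=> 1)); last by move=> j /x0 ->; rewrite expR0.
  (* The index [k : 'I_n] itself shows that [n] is positive, hence [n.-1 + 1 = n]. *)
  by rewrite sumr_const cardC1 card_ord natr1 prednK// (leq_trans _ (ltn_ord k)).
have x0 j : x j = 0 by apply/eqP; rewrite -[_ == _]negbK.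
rewrite big1// expR0 addrC (eq_bigr (fun=> 1)) ?sumr_const ?card_ord//.
by move=> j _; rewrite x0 expR0.
Qed.

Section MomentGeneratingFunction.
Context (d : measure_display) (T : measurableType d) (R : realType).
Variable P : probability T R.

Lemma mmt_gen_fun_ge0 (X : T -> R) (t : R) : (0 <= 'M_P X t)%E.
Proof. by apply: expectation_ge0 => w; exact: expR_ge0. Qed.

Lemma mmt_gen_fun0 (X : T -> R) : 'M_P X 0 = 1%E.
Proof.
rewrite /mmt_gen_fun [X in 'E_P[X]%E](_ : _ = cst 1) ?expectation_cst//.
by apply/funext => w /=; rewrite mulr0 expR0.
Qed.

(* The additive form avoids subtracting possibly infinite expectations. *)
Lemma mmt_gen_fun_sum_disjoint (n : nat) (X : 'I_n -> {RV P >-> R}) (t : R) :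
  (forall i j, i != j -> {ae P, forall w, X i w * X j w = 0}) ->
  ('M_P (fun w => \sum_(j < n) X j w)%R t + n%:R%:E =
   \sum_(j < n) 'M_P (X j) t + 1)%E.
Proof.
move=> X_disj; rewrite /mmt_gen_fun unlock.
have mcst (c : R) : measurable_fun [set: T] (EFin \o cst c).
  by apply/measurable_EFinP; exact: measurable_cst.
have mexp (Y : T -> R) : measurable_fun setT Y ->
    measurable_fun setT (EFin \o (expR \o (t \o* Y))).
  move=> mY; apply/measurable_EFinP; apply: measurableT_comp => //.
  exact: (measurableT_comp (@mulrr_measurable _ _ t) mY).
have mX j : measurable_fun setT (EFin \o (expR \o (t \o* X j))).
  exact: mexp.
have mS : measurable_fun setT
    (EFin \o (expR \o (t \o* fun w => \sum_(j < n) X j w))).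
  by apply: mexp; exact: measurable_sum.
(* Since [P] has total mass 1, the constants become integrals too, and the claim reduces to an
   almost everywhere equality of two nonnegative integrands. *)
have cstE (c : R) : c%:E = (\int[P]_w c%:E)%E.
  by rewrite integral_cst//= probability_setT mule1.
rewrite (cstE n%:R) (cstE 1) -ge0_integral_sum//; last first.
  by move=> j w _; rewrite lee_fin expR_ge0.
rewrite -!ge0_integralD//.
- apply: ge0_ae_eq_integral => //=.
  + exact: emeasurable_funD.
  + by apply: emeasurable_funD => //; exact: emeasurable_sum.
  + by move=> w _; rewrite -EFinD lee_fin addr_ge0 ?expR_ge0.
  + by move=> w _; rewrite adde_ge0// sume_ge0.
  (* There are finitely many pairs of indices, so one null set serves for all of them. *)
  + have : \forall w \near almost_everywhere P,
        forall i j, i != j -> X i w * X j w = 0.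
      apply: filter_forall => i; apply: filter_forall => j.
      have [->|ij] := eqVneq i j; first exact: nearW.
      by apply: filterS (X_disj _ _ ij) => w ->.
    apply: filterS => w Xw _; rewrite sumEFin -!EFinD mulr_suml.
    rewrite expR_sum_disjoint// => i j ij.
    by rewrite mulrACA Xw// mul0r.
- by move=> w _; rewrite sume_ge0// => j _; rewrite lee_fin expR_ge0.
- exact: emeasurable_sum.
- by move=> w _; rewrite lee_fin expR_ge0.
Qed.

(* When m = E exp (t X) > 1, admissibility of tau at t reads
   tau >= sqrt (2 ln m / t^2), a closed condition that passes to the infimum. *)
Lemma sub_norm_attained (X : T -> R) :
  (exists tau, sub_bound P X tau) -> sub_bound P X (fine (sub_norm P X)).
Proof.
move=> [tau0 Xtau0]; have [tau0_ge0 Mtau0] := Xtau0.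
have norm_ge0 : (0 <= sub_norm P X)%E.
  by apply/ereal_infP => _ [tau [tau_ge0 _] <-]; rewrite lee_fin.
have norm_le : (sub_norm P X <= tau0%:E)%E.
  by apply: ereal_inf_lbound; exists tau0.
have norm_fin : sub_norm P X \is a fin_num.
  by rewrite ge0_fin_numE// (le_lt_trans norm_le)// ltry.
split=> [|t]; first exact: fine_ge0.
have M_fin : 'M_P X t \is a fin_num.
  by rewrite ge0_fin_numE ?mmt_gen_fun_ge0// (le_lt_trans (Mtau0 t))// ltry.
rewrite -(fineK M_fin) lee_fin; set m := fine _; set b := fine _.
(* If [m <= 1], every [b] works, since the exponential bound is at least 1. *)
have [m_le1|m_gt1] := leP m 1.
  rewrite (le_trans m_le1)// -[leLHS]expR0 ler_expR.
  by rewrite divr_ge0// mulr_ge0// sqr_ge0.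
have m_gt0 : 0 < m by exact: lt_trans m_gt1.
have lnm_gt0 : 0 < ln m by exact: ln_gt0.
have lnm_le tau : sub_bound P X tau -> ln m <= t ^+ 2 * tau ^+ 2 / 2.
  case=> _ /(_ t); rewrite -(fineK M_fin) lee_fin -/m => m_le.
  by rewrite -ler_expR lnK.
(* At [t = 0] the admissibility of [tau0] would force [ln m <= 0], against [m > 1]. *)
have t2_gt0 : 0 < t ^+ 2.
  rewrite lt0r sqr_ge0 andbT; apply/eqP => t0.
  by move: (lnm_le _ Xtau0); rewrite t0 !mul0r leNgt lnm_gt0.
have c_ge0 : 0 <= 2 * ln m / t ^+ 2.
  by apply: divr_ge0; [apply: mulr_ge0 => //|]; exact: ltW.
have : Num.sqrt (2 * ln m / t ^+ 2) ^+ 2 <= b ^+ 2.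
  rewrite ler_pXn2r ?nnegrE ?sqrtr_ge0 ?fine_ge0//.
  rewrite -lee_fin fineK//; apply/ereal_infP => _ [tau Xtau <-].
  rewrite lee_fin -[leRHS]ger0_norm -?sqrtr_sqr; last by case: Xtau.
  rewrite ler_wsqrtr// ler_pdivrMr//.
  by have := lnm_le _ Xtau; lra.
rewrite sqr_sqrtr// ler_pdivrMr// => lnm_leb.
rewrite -[leLHS]lnK// ler_expR; lra.
Qed.

End MomentGeneratingFunction.

Theorem theorem3p1 (d : measure_display) (T : measurableType d) (R : realType)
    (P : probability T R) (n : nat) (hn : (1 <= n)%N)
    (eta : 'I_n -> {RV P >-> R})
    (eta_subgaussian : forall j : 'I_n, subgaussian (eta j))
    (eta_disjoint : forall i j : 'I_n, i != j ->
       {ae P, forall w, eta i w * eta j w = 0}) :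
  (sub_norm P (fun w => \sum_(j < n) eta j w)%R
   <= Gfun (fun j : 'I_n => fine (sub_norm P (eta j)) ^+ 2)%R)%E.
Proof.
set y : 'I_n -> R := fun j => _.
have eta_bound j : sub_bound P (eta j) (fine (sub_norm P (eta j))).
  by apply: sub_norm_attained; case: (eta_subgaussian j).
pose A mu := \sum_(j < n) expR (mu * y j) - (n%:R - 1).
have A_ge1 mu : 0 < mu -> 1 <= A mu.
  move=> mu_gt0; suff: n%:R <= \sum_(j < n) expR (mu * y j).
    by rewrite /A; lra.
  rewrite -[n in n%:R]card_ord -sumr_const ler_sum// => j _.
  by rewrite -[leLHS]expR0 ler_expR mulr_ge0 ?sqr_ge0 ?ltW.
have G_ge mu : 0 < mu ->
    ((Num.sqrt (mu^-1 * ln (A mu)))%:E <= Gfun y)%E.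
  by move=> mu_gt0; apply: ereal_sup_ubound; exists mu.
have G_ge0 : (0 <= Gfun y)%E.
  by apply: le_trans (G_ge 1 ltr01); rewrite lee_fin sqrtr_ge0.
(* Being nonnegative, [Gfun y] is either finite or [+oo], and the latter makes the bound trivial. *)
have [G_fin|] := boolP (Gfun y \is a fin_num); last first.
  by rewrite ge0_fin_numE// -leNgt leye_eq => /eqP ->; rewrite leey.
rewrite -(fineK G_fin); set g := fine _.
have g_ge0 : 0 <= g by exact: fine_ge0.
apply: ereal_inf_lbound; exists g => //; split=> // t.
(* The supremum only ranges over positive [mu], so [t = 0] is treated apart. *)
have [->|t_neq0] := eqVneq t 0.
  by rewrite mmt_gen_fun0 expr0n/= !mul0r expR0.
pose mu := t ^+ 2 / 2.
have mu_gt0 : 0 < mu by rewrite divr_gt0// exprn_even_gt0.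
have muE b : t ^+ 2 * b / 2 = mu * b by rewrite /mu mulrAC.
have A_le : A mu <= expR (mu * g ^+ 2).
  rewrite -[leLHS]lnK ?ler_expR; last first.
    by rewrite posrE (lt_le_trans ltr01) ?A_ge1.
  rewrite -ler_pdivrMl//.
  (* Nonnegativity, from [1 <= A mu], lets the square root in [Gfun] be squared back without
     loss. *)
  have c_ge0 : 0 <= mu^-1 * ln (A mu).
    by apply: mulr_ge0; [rewrite invr_ge0 ltW|rewrite ln_ge0 ?A_ge1].
  rewrite -[leLHS]sqr_sqrtr// ler_pXn2r ?nnegrE ?sqrtr_ge0//.
  by rewrite -lee_fin fineK// G_ge.
rewrite muE; apply: le_trans (_ : ((A mu)%:E <= _)%E); last by rewrite lee_fin.
(* Adding the finite quantity [n] to both sides preserves and reflects the inequality, and brings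
   the left side into the form of the additive identity; the rest is a termwise comparison. *)
rewrite -(leeD2rE (x := n%:R%:E))// mmt_gen_fun_sum_disjoint//.
rewrite -EFinD [A mu + _](_ : _ = \sum_(j < n) expR (mu * y j) + 1); last first.
  by rewrite /A; lra.
rewrite EFinD leeD2r// -sumEFin; apply: lee_sum => j _.
by rewrite -muE; case: (eta_bound j) => _; apply.
Qed.
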